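(* Let $n\ge 1$ and let $k$ be a field. Consider the letters $X=\{r(\overline{\alpha}) : \alpha\in S_{n+1}\setminus\{1\}\}$ and the positive braid monoid $B_{n+1}^{+}=\langle X \mid r(\overline{\alpha})r(\overline{\beta})=r(\overline{\alpha\beta})\ (\alpha\perp\beta)\rangle$. Then the set of relations $$r(\overline{\alpha})r(\overline{\beta})=r(\overline{\alpha\beta})\quad(\alpha\perp\beta),$$ $$r(\overline{\alpha})r(\overline{\beta\gamma})=r(\overline{\alpha\beta})r(\overline{\gamma})\quad(\alpha\perp\beta\perp\gamma),$$ where $\alpha,\beta,\gamma$ range over $S_{n+1}\setminus\{1\}$, is a Gröbner–Shirshov basis of $B_{n+1}^{+}$ with respect to the deg-lex ordering on $X^*$.
   Context: $S_{n+1}$ is the symmetric group with Coxeter generators $s_i=(i,i+1)$, $1\le i\le n$. Put $s_{ji}=s_js_{j-1}\cdots s_i$ for $j\ge i$ and $s_{j,j+1}=1$. Every $\alpha\in S_{n+1}$ equals a unique word of the form $\overline{\alpha}=s_{1i_1}s_{2i_2}\cdots s_{ni_n}$ with $1\le i_j\le j+1$ (its normal form); $|\overline{\alpha}|$ is the number of letters $s_i$ in this word (it is the Coxeter length of $\alpha$). Write $\alpha\perp\beta$ if $|\overline{\alpha\beta}|=|\overline{\alpha}|+|\overline{\beta}|$; $\alpha\perp\beta\perp\gamma$ means $\alpha\perp\beta$ and $\beta\perp\gamma$. The symbol $r(\overline{\alpha})$ denotes a formal letter indexed by $\overline{\alpha}$. Ordering: let $s_1<\cdots<s_n$. Order $X$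 by $r(\overline{\alpha})<r(\overline{\beta})$ iff $|\overline{\alpha}|>|\overline{\beta}|$, or $|\overline{\alpha}|=|\overline{\beta}|$ and $\overline{\alpha}$ is lexicographically smaller than $\overline{\beta}$. The deg-lex ordering on the free monoid $X^*$ compares words first by number of letters of $X$, then lexicographically. Gröbner–Shirshov bases: for a monomial well-ordering on $X^*$ and nonzero $f\in k\langle X\rangle$ (free associative algebra with unit), $\bar f$ is the largest word occurring in $f$; $f$ is monic if the coefficient of $\bar f$ is 1. For monic $f,g$: if $w=\bar f b=a\bar g$ with $|\bar f|+|\bar g|>|w|$, then $(f,g)_w=fb-ag$ is an (intersection) composition; if $w=\bar f=a\bar g b$, then $(f,g)_w=f-agb$ is an (inclusion) composition. A composition is trivial modulo $(S,w)$ if it equals $\sum\alpha_i a_is_ib_i$ with $\alpha_i\in k$, $a_i,b_i\in X^*$, $s_i\in S$ and $a_i\overline{s_i}b_i<w$. A set $S$ of monic polynomials is a Gröbner–Shirshov basis in $k\langle X\rangle$ if all compositions of its elements are trivial. A relation $u=v$ between words is identified with the polynomial $u-v$ (multiplied by $-1$ if needed to be monic; identities $u=u$ are discarded). A set of relations $S$ is a Gröbner–Shirshov basis of a monoid $\langle X\mid R\rangle$ if $S$ is a Gröbner–Shirshov basis in $k\langle X\rangle$ and $S$ generates the same two-sided ideal of $k\langle X\rangle$ as $R$ (so $S$ presents the same monoid). *)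

(* Defs.v *)
From HB Require Import structures.
From mathcomp Require Import all_boot all_algebra all_fingroup.
From mathcomp Require Import finmap.
From mathcomp Require Import monalg.

Set Implicit Arguments.
Unset Strict Implicit.
Unset Printing Implicit Defensive.

Import GRing.Theory.

(* {malg k[{fmonom T}]} is the free associative unital algebra k<T>, with basis
   the words {fmonom T}; << u >> is the word u seen in the algebra, and f@_u is
   the coefficient of u in f. *)

Section GroebnerShirshov.

Context (k : fieldType) (T : choiceType) (lt : rel {fmonom T}).

Local Notation word := {fmonom T}.
Local Notation alg := {malg k[{fmonom T}]}.
Local Notation "u ** v" := (mmul u v) (at level 40, left associativity).

Implicit Types (f g h : alg) (u v w : word).

Local Open Scope ring_scope.

Definition is_lead f u :=
  u \in msupp f /\ (forall v, v \in msupp f -> v != u -> lt v u).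

Definition is_monic f := exists2 u, is_lead f u & f@_u = 1.

Definition trivial_mod (S : alg -> Prop) w h :=
  exists (m : nat) (c : 'I_m -> k) (a b : 'I_m -> word) (s : 'I_m -> alg),
    (forall i, S (s i) /\ exists2 v, is_lead (s i) v & lt (a i ** v ** b i) w)
    /\ h = \sum_(i < m) c i *: (<< a i >> * s i * << b i >>).

Definition GS_basis (S : alg -> Prop) :=
  [/\ forall f, S f -> is_monic f,
      forall f g u v a b, S f -> S g -> is_lead f u -> is_lead g v ->
        u ** b = a ** v -> (fdeg (u ** b) < fdeg u + fdeg v)%N ->
        trivial_mod S (u ** b) (f * << b >> - << a >> * g)
    & forall f g u v a b, S f -> S g -> is_lead f u -> is_lead g v ->
        u = a ** v ** b ->
        trivial_mod S u (f - << a >> * g * << b >>)].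

Definition in_ideal (S : alg -> Prop) f :=
  exists (m : nat) (a b s : 'I_m -> alg),
    (forall i, S (s i)) /\ f = \sum_(i < m) a i * s i * b i.

Definition rel_poly (R : word -> word -> Prop) f :=
  exists u v, [/\ R u v, u != v
    & f = if lt v u then << u >> - << v >> else << v >> - << u >>].

(* The relations S form a Groebner-Shirshov basis of the monoid <T | R>. *)
Definition monoid_GS_basis (R S : word -> word -> Prop) :=
  GS_basis (rel_poly S) /\
  (forall f, in_ideal (rel_poly S) f <-> in_ideal (rel_poly R) f).

End GroebnerShirshov.

Fixpoint lexlt (T : eqType) (lt : rel T) (s t : seq T) : bool :=
  match s, t with
  | x :: s', y :: t' => lt x y || ((x == y) && lexlt lt s' t')
  | [::], _ :: _ => true
  | _, [::] => false
  end.

Definition deglex (T : choiceType) (lt : rel T) (u v : {fmonom T}) : bool :=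
  (fdeg u < fdeg v) || ((fdeg u == fdeg v) && lexlt lt u v).

Section SymmetricGroup.

Context (n : nat).

Local Open Scope group_scope.

Implicit Types (al be : 'S_n.+1).

(* The points 1, ..., n+1 are represented by 0, ..., n : 'I_n.+1, so that
   sgen i, meaningful for 1 <= i <= n, is the transposition (i, i+1). *)
Definition sgen (i : nat) : 'S_n.+1 := tperm (inord i.-1) (inord i).

Definition seval (w : seq nat) : 'S_n.+1 := \prod_(i <- w) sgen i.

(* The word s_j s_(j-1) ... s_i, empty for i = j+1. *)
Definition sdesc (j i : nat) : seq nat := rev (iota i (j.+1 - i)).

(* A code c lists the indices i_1, ..., i_n of a normal form: the entry of
   j : 'I_n is i_(j+1). *)
Definition nf_code (c : {ffun 'I_n -> 'I_n.+2}) : bool :=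
  [forall j : 'I_n, 0 < c j <= j.+2].

Definition nf_word (c : {ffun 'I_n -> 'I_n.+2}) : seq nat :=
  flatten [seq sdesc j.+1 (c j) | j : 'I_n <- enum 'I_n].

(* The default [::] is never used: see normal_formP. *)
Definition normal_form al : seq nat :=
  if [pick c | nf_code c && (seval (nf_word c) == al)] is Some c
  then nf_word c else [::].

Definition slen al : nat := size (normal_form al).

Definition perp al be : bool := slen (al * be) == slen al + slen be.

Lemma seval_cons i w : seval (i :: w) = sgen i * seval w.
Proof. by rewrite /seval big_cons. Qed.

Lemma seval_cat w1 w2 : seval (w1 ++ w2) = seval w1 * seval w2.
Proof. by rewrite /seval big_cat. Qed.

Lemma sdescS j i : i <= j.+1 -> sdesc j.+1 i = j.+1 :: sdesc j i.
Proof.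
move=> le_ij; rewrite /sdesc subSn // -addn1 iotaD rev_cat /=.
by rewrite subnKC.
Qed.

Lemma sdesc_nil j : sdesc j j.+1 = [::].
Proof. by rewrite /sdesc subnn. Qed.

Lemma seval_fix w (x : 'I_n.+1) : all (fun i => i < x) w -> seval w x = x.
Proof.
elim: w => [|i w IHw] /=; first by rewrite /seval big_nil perm1.
case/andP=> lt_ix /IHw IH; rewrite seval_cons permM tpermD //.
- apply/eqP=> /(congr1 val); rewrite /= inordK => [def_x|].
    by move: lt_ix; rewrite -def_x ltnNge leq_pred.
  by apply: leq_ltn_trans (leq_pred _) (ltn_trans lt_ix _).
- apply/eqP=> /(congr1 val); rewrite /= inordK => [def_x|].
    by move: lt_ix; rewrite -def_x ltnn.
  exact: ltn_trans lt_ix _.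
Qed.

Lemma all_sdesc j i m : j < m -> all (fun l => l < m) (sdesc j i).
Proof.
move=> lt_jm; apply/allP=> l; rewrite mem_rev mem_iota => /andP[le_il].
have [le_ij | lt_ji] := leqP i j.+1.
  by rewrite subnKC // => lt_lj; apply: leq_ltn_trans lt_jm.
have /eqP-> : j.+1 - i == 0 by rewrite subn_eq0 ltnW.
by rewrite addn0 ltnNge le_il.
Qed.

Lemma seval_sdesc j i :
  j <= n -> 0 < i <= j.+1 -> seval (sdesc j i) (inord j) = inord i.-1.
Proof.
elim: j => [|j IHj] le_jn /andP[i_gt0 le_ij].
  have -> : i = 1%N by apply/eqP; rewrite eqn_leq le_ij.
  by rewrite /seval sdesc_nil big_nil perm1.
move: le_ij; rewrite leq_eqVlt => /predU1P[-> | le_ij].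
  by rewrite /seval sdesc_nil big_nil perm1.
rewrite sdescS // seval_cons permM tpermR IHj ?i_gt0 //; exact: ltnW.
Qed.

Let pref (i : nat -> nat) m := flatten [seq sdesc j.+1 (i j) | j <- iota 0 m].

Let prefS i m : pref i m.+1 = pref i m ++ sdesc m.+1 (i m).
Proof.
have iota_m : iota 0 m.+1 = rcons (iota 0 m) m by rewrite -addn1 iotaD cats1.
by rewrite /pref iota_m map_rcons flatten_rcons.
Qed.

Let all_pref i m : all (fun l => l < m.+1) (pref i m).
Proof.
elim: m => [|m IHm] //; rewrite prefS all_cat all_sdesc // andbT.
by apply: sub_all IHm => l; apply: ltnW.
Qed.

Let pref_ex m al : m <= n -> (forall x : 'I_n.+1, m < x -> al x = x) ->
  exists2 i : nat -> nat, (forall j, 0 < i j <= j.+2) & seval (pref i m) = al.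
Proof.
elim: m al => [|m IHm] al le_mn fix_al.
  exists (fun=> 1%N) => //; rewrite /seval big_nil; apply/permP=> x.
  rewrite perm1; have [x0 | x_gt0] := posnP x; last by rewrite fix_al.
  apply/val_inj; rewrite /= x0; apply/esym/eqP.
  rewrite -leqn0 leqNgt; apply/negP=> alx_gt0.
  by move: (alx_gt0); rewrite (perm_inj (fix_al _ alx_gt0)) x0.
pose y := al (inord m.+1).
have le_y : y <= m.+1.
  rewrite leqNgt; apply/negP=> lt_y.
  have /(congr1 val) := perm_inj (fix_al _ lt_y).
  by rewrite /= inordK // => def_y; move: lt_y; rewrite def_y ltnn.
have fix_d (x : 'I_n.+1) : m.+1 < x -> seval (sdesc m.+1 y.+1) x = x.
  by move=> lt_mx; apply: seval_fix; apply: all_sdesc.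
have [x lt_mx | i i_ok def_al] :=
    IHm (al * (seval (sdesc m.+1 y.+1))^-1) (ltnW le_mn).
  rewrite permM; apply: (canLR (permK _)).
  move: lt_mx; rewrite leq_eqVlt => /predU1P[x_m | lt_mx].
    have -> : x = inord m.+1 by apply: val_inj; rewrite /= inordK.
    by rewrite seval_sdesc //= inord_val.
  by rewrite fix_al // fix_d.
exists (fun j => if j == m then y.+1 else i j).
  by move=> j; case: eqP => [->|_].
rewrite prefS eqxx seval_cat.
suff -> : pref (fun j => if j == m then y.+1 else i j) m = pref i m.
  by rewrite def_al mulgKV.
congr flatten; apply/eq_in_map=> j; rewrite mem_iota add0n => /andP[_ lt_jm].
by rewrite ltn_eqF.
Qed.

Let pref_inj m i i' : m <= n ->
    (forall j, j < m -> 0 < i j <= j.+2) ->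
    (forall j, j < m -> 0 < i' j <= j.+2) ->
  seval (pref i m) = seval (pref i' m) -> pref i m = pref i' m.
Proof.
elim: m => [|m IHm] // le_mn i_ok i'_ok eq_ii'.
suff eq_m : i m = i' m.
  move: eq_ii'; rewrite !prefS !seval_cat eq_m => /mulIg eq_ii'.
  rewrite IHm //; first exact: ltnW.
    by move=> j lt_jm; apply: i_ok; apply: ltnW.
  by move=> j lt_jm; apply: i'_ok; apply: ltnW.
have val_m l : (forall j, j < m.+1 -> 0 < l j <= j.+2) ->
    seval (pref l m.+1) (inord m.+1) = (l m).-1 :> nat.
  move=> l_ok; have /andP[l_gt0 l_le] := l_ok m (ltnSn m).
  rewrite prefS seval_cat permM (seval_fix (w := pref l m)) ?inordK //.
  rewrite seval_sdesc // ?l_gt0 // inordK // -ltnS prednK //.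
  exact: leq_trans l_le _.
move: (val_m _ i_ok); rewrite eq_ii' val_m //.
have /andP[i_gt0 _] := i_ok m (ltnSn m).
have /andP[i'_gt0 _] := i'_ok m (ltnSn m).
by move=> eq_p; rewrite -(prednK i_gt0) -(prednK i'_gt0) eq_p.
Qed.

Let nf_wordE (c : {ffun 'I_n -> 'I_n.+2}) (i : nat -> nat) :
  (forall j : 'I_n, i j = c j) -> nf_word c = pref i n.
Proof.
move=> def_i; rewrite /nf_word /pref -val_enum_ord -map_comp; congr flatten.
by apply: eq_map => j /=; rewrite def_i.
Qed.

Lemma normal_formP al :
  exists2 c, nf_code c & normal_form al = nf_word c /\ seval (nf_word c) = al.
Proof.
rewrite /normal_form; case: pickP => [c /andP[c_ok /eqP c_al]|no_c].
  by exists c.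
have [x| i i_ok def_al] := @pref_ex n al (leqnn n).
  by rewrite ltnNge -ltnS ltn_ord.
pose c : {ffun 'I_n -> 'I_n.+2} := [ffun j : 'I_n => inord (i j)].
have c_i (j : 'I_n) : i j = c j.
  rewrite ffunE inordK //; have /andP[_ le_i] := i_ok j.
  by apply: leq_ltn_trans le_i _; rewrite !ltnS.
case/idP: (no_c c); rewrite (nf_wordE c_i) def_al eqxx andbT.
by apply/forallP=> j; rewrite -c_i.
Qed.

Lemma normal_form_uniq c :
  nf_code c -> normal_form (seval (nf_word c)) = nf_word c.
Proof.
move=> /forallP c_ok; have [c' /forallP c'_ok [-> ]] :=
  normal_formP (seval (nf_word c)).
pose ext (d : {ffun 'I_n -> 'I_n.+2}) (j : nat) : nat :=
  if insub j is Some j' then d j' else 0%N.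
have extE d (j : 'I_n) : ext d j = d j by rewrite /ext valK.
rewrite !(nf_wordE (extE _)) => /pref_inj-> // j lt_jn.
  by rewrite (extE c' (Ordinal lt_jn)).
by rewrite (extE c (Ordinal lt_jn)).
Qed.

Lemma seval_normal_form al : seval (normal_form al) = al.
Proof. by have [c _ [-> ->]] := normal_formP al. Qed.

Lemma slen_eq0 al : (slen al == 0) = (al == 1).
Proof.
apply/idP/eqP=> [/nilP nf0 | ->].
  by rewrite -[al]seval_normal_form nf0 /seval big_nil.
pose c : {ffun 'I_n -> 'I_n.+2} := [ffun j : 'I_n => inord j.+2].
have c_j (j : 'I_n) : c j = j.+2 :> nat.
  by rewrite ffunE inordK // !ltnS.
have nf0 : nf_word c = [::].
  rewrite (@nf_wordE c (fun j => j.+2)) // /pref.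
  by elim: (iota 0 n) => //= j s ->; rewrite sdesc_nil.
have := @normal_form_uniq c; rewrite nf0 /seval big_nil /slen => -> //.
by apply/forallP=> j; rewrite c_j /=.
Qed.

Lemma perp_neq1 al be : al != 1 -> perp al be -> al * be != 1.
Proof.
by rewrite -!slen_eq0 => al1 /eqP->; rewrite addn_eq0 negb_and al1.
Qed.

End SymmetricGroup.

(* The alphabet X: the formal letter r(al), for al != 1. *)
Definition letter (n : nat) := {al : 'S_n.+1 | al != 1%g}.

Definition letter_lt (n : nat) : rel (letter n) := fun x y =>
  (slen (val y) < slen (val x)) ||
  ((slen (val x) == slen (val y)) &&
   lexlt ltn (normal_form (val x)) (normal_form (val y))).

(* In both types of relations, the letters for al * be and be * ga exist by
   perp_neq1; they are named by the equations they satisfy. *)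
Inductive braid_rel (n : nat) : {fmonom letter n} -> {fmonom letter n} -> Prop :=
| BraidRel (a b ab : letter n) of
    perp (val a) (val b) & val ab = (val a * val b)%g :
    braid_rel (FMonom [:: a; b]) (FMonom [:: ab]).

Inductive garside_rel (n : nat) : {fmonom letter n} -> {fmonom letter n} -> Prop :=
| GarsideBraid u v of braid_rel u v : garside_rel u v
| GarsideSlide (a b c ab bc : letter n) of
    perp (val a) (val b) & perp (val b) (val c) &
    val ab = (val a * val b)%g & val bc = (val b * val c)%g :
    garside_rel (FMonom [:: a; bc]) (FMonom [:: ab; c]).

(* Main.v *)
(* All leading words have length two, so there are two kinds of compositions.
   Write relations uniformly as al . (be ga) = (al be) . ga, where trivial
   letters are dropped and al, be are nontrivial.
   - Overlap x y z with y = be ga and z = de ep: both (x be) . ga . z and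
     x . (y de) . ep are linked to (x be) . (ga de) . ep.
   - Two relations with the same leading word x y, given by two left divisors of
     y: each can be replaced by a Coxeter generator dividing it, and two
     generators by the longest element of the dihedral subgroup they generate.
   The length of a normal form is identified with the number of inversions, from
   which the descent criteria for generators are read off. *)

Require Import Defs.
From mathcomp Require Import all_boot all_algebra all_fingroup.
From mathcomp Require Import finmap monalg.
From mathcomp Require Import zify.

Set Implicit Arguments.
Unset Strict Implicit.
Unset Printing Implicit Defensive.

Import GRing.Theory.

(** * Coxeter length as the number of inversions *)

Section Length.

Variable n : nat.
Implicit Types (al be ga : 'S_n.+1) (i j m : nat) (w : seq nat).

Local Open Scope group_scope.

Local Notation sgen := (sgen n).
Local Notation seval := (seval n).

Definition inversions al : nat := \sum_(p : 'I_n.+1 * 'I_n.+1) ((p.1 < p.2) && (al p.2 < al p.1)).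

Lemma sgenS i : sgen i.+1 = tperm (inord i) (inord i.+1).
Proof. by []. Qed.

Lemma sgenK i : sgen i * sgen i = 1.
Proof. exact: tperm2. Qed.

Lemma sgenV i : (sgen i)^-1 = sgen i.
Proof. exact: tpermV. Qed.

Lemma sgen_lt i (x y : 'I_n.+1) : i < n -> x < y ->
  (x, y) != (inord i, inord i.+1) -> sgen i.+1 x < sgen i.+1 y.
Proof.
move=> lt_in lt_xy; rewrite xpair_eqE -!val_eqE /= !inordK ?ltnS ?(ltnW lt_in) //.
rewrite sgenS; case: tpermP => [/(congr1 val) | /(congr1 val) | /eqP + /eqP];
  case: tpermP => [/(congr1 val) | /(congr1 val) | /eqP + /eqP];
  rewrite -?val_eqE /= ?inordK ?ltnS ?(ltnW lt_in) //; lia.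
Qed.

(** Products act by their left factor first, so multiplying by [sgen i.+1] on the left swaps two
    adjacent positions. Exactly the pair [q] of these positions becomes an inversion; the other
    pairs are permuted with their order kept. *)
Lemma inversions_sgenM_asc i al : i < n -> al (inord i) < al (inord i.+1) ->
  inversions (sgen i.+1 * al) = (inversions al).+1.
Proof.
move=> lt_in asc; pose s := sgen i.+1.
pose q : 'I_n.+1 * 'I_n.+1 := (inord i, inord i.+1).
have sK x : s (s x) = x by rewrite -permM sgenK perm1.
have lt_q : q.1 < q.2 by rewrite !inordK // ltnS ltnW.
pose h (p : 'I_n.+1 * 'I_n.+1) := (s p.1, s p.2).
have hK : involutive h by case=> x y; rewrite /h !sK.
rewrite /inversions (bigD1 q) //= (bigD1 (P := xpredT) q) //=.
rewrite lt_q !permM /s sgenS tpermL tpermR asc [al _ < al _]ltnNge ltnW //= add1n add0n.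
congr _.+1; rewrite -sgenS -/s [LHS]big_mkcond [RHS]big_mkcond (reindex_inj (inv_inj hK)) /=.
apply: eq_bigr => -[x y] _; rewrite /h /= !permM !sK.
(* As [s] is an involution, this implication also yields its converse. *)
have cl (u v : 'I_n.+1) : (u, v) != q -> u < v -> ((s u, s v) != q) && (s u < s v).
  move=> ne_q lt_uv; rewrite sgen_lt // andbT; apply: contraTneq lt_uv => -[su sv].
  have -> : u = inord i.+1 by rewrite -[u]sK su /s sgenS tpermL.
  have -> : v = inord i by rewrite -[v]sK sv /s sgenS tpermR.
  by rewrite -leqNgt ltnW.
have ifE (b c d : bool) : (if b then nat_of_bool (c && d) else 0%N) = (b && c) && d by case: b.
rewrite !ifE; have -> : ((s x, s y) != q) && (s x < s y) = ((x, y) != q) && (x < y).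
  apply/idP/idP => /andP[ne_q lt_xy]; last exact: cl.
  by have := cl _ _ ne_q lt_xy; rewrite !sK.
by [].
Qed.

Lemma inversions_sgenM_desc i al : i < n -> al (inord i.+1) < al (inord i) ->
  inversions al = (inversions (sgen i.+1 * al)).+1.
Proof.
move=> lt_in desc; rewrite -(@inversions_sgenM_asc i) // ?mulgA ?sgenK ?mul1g //.
by rewrite !permM sgenS tpermL tpermR.
Qed.

Lemma perm_inord_neqS i al : i < n -> (al (inord i) == al (inord i.+1) :> nat) = false.
Proof.
move=> lt_in; apply/eqP => /val_inj/perm_inj/(congr1 val).
by rewrite /= !inordK ?ltnS ?(ltnW lt_in) //; lia.
Qed.

(** [al] carries an inversion [(x, y)] to the inversion [(al y, al x)] of its inverse. *)
Lemma inversionsV al : inversions al^-1 = inversions al.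
Proof.
pose h (p : 'I_n.+1 * 'I_n.+1) := (al p.2, al p.1).
have h_inj : injective h by case=> x y [x' y'] [/perm_inj-> /perm_inj->].
by rewrite /inversions (reindex_inj h_inj) /=; apply: eq_bigr => p _; rewrite !permK andbC.
Qed.

Lemma inversions1 : inversions 1 = 0.
Proof. by rewrite /inversions big1 // => p _; rewrite !perm1; case: ltngtP. Qed.

Lemma inversions_mulsgen_asc i al : i < n -> al^-1 (inord i) < al^-1 (inord i.+1) ->
  inversions (al * sgen i.+1) = (inversions al).+1.
Proof. by move=> lt_in asc; rewrite -inversionsV invMg sgenV inversions_sgenM_asc // inversionsV. Qed.

Lemma sdesc_rcons j i : i <= j -> sdesc j i = rcons (sdesc j i.+1) i.
Proof. by move=> le_ij; rewrite /sdesc subSS subSn //= rev_cons. Qed.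

(** Induction on [l], the number of letters of the descending word. Every appended letter creates
    one inversion: the larger of the two values it exchanges sits at position [m.+1], the smaller
    one before it. *)
Lemma inversions_mulsdesc m al l : m < n -> (forall x : 'I_n.+1, m < x -> al x = x) ->
  l <= m.+1 -> inversions (al * seval (sdesc m.+1 (m.+2 - l))) =
    inversions al + size (sdesc m.+1 (m.+2 - l)).
Proof.
move=> lt_mn fix_al; elim: l => [|l IHl] le_lm.
  by rewrite subn0 sdesc_nil /seval big_nil mulg1 addn0.
(* [i.+1] is the letter appended in passing from [l] to [l.+1]. *)
have [i def_i] : exists i, m.+2 - l.+1 = i.+1 by exists (m - l); lia.
have def_i1 : m.+2 - l = i.+2 by lia.
have lt_in : i < n by lia.
move/(_ (ltnW le_lm)): IHl; rewrite def_i def_i1 (@sdesc_rcons _ i.+1) ?size_rcons; last by lia.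
set w := sdesc _ _ => IHl.
rewrite -cats1 seval_cat {2}/seval big_seq1 mulgA.
rewrite inversions_mulsgen_asc ?IHl ?addnS //.
set al' := al * seval w.
have al'_fix (x : 'I_n.+1) : m.+1 < x -> al' x = x.
  by move=> lt_mx; rewrite permM fix_al ?seval_fix ?all_sdesc // ltnW.
have al'_m : al' (inord m.+1) = inord i.+1.
  by rewrite permM fix_al ?inordK // seval_sdesc //; lia.
rewrite -al'_m permK inordK // ltn_neqAle; apply/andP; split.
  apply/eqP => eq_m; have : al' (inord m.+1) = inord i.
    by rewrite -eq_m inord_val permKV.
  by rewrite al'_m => /(congr1 val); rewrite /= !inordK; lia.
(* Points above [m.+1] are fixed by [al'], whereas [i] lies below [m.+1]. *)
rewrite leqNgt; apply/negP => lt_m; have := lt_m.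
rewrite -{1}(al'_fix _ lt_m) permKV inordK; lia.
Qed.

Lemma inversions_nf_word (c : {ffun 'I_n -> 'I_n.+2}) :
  nf_code c -> inversions (seval (nf_word c)) = size (nf_word c).
Proof.
(* The default 0 is never read, as only prefixes of at most [n] factors matter. *)
move=> /forallP c_ok; pose i (j : nat) : nat := if insub j is Some j' then c j' else 0%N.
have iE (j : 'I_n) : i j = c j by rewrite /i valK.
pose pref m := flatten [seq sdesc j.+1 (i j) | j <- iota 0 m].
have -> : nf_word c = pref n.
  rewrite /nf_word /pref -val_enum_ord -map_comp; congr flatten.
  by apply: eq_map => j /=; rewrite iE.
suff: forall m, m <= n -> inversions (seval (pref m)) = size (pref m) by exact.
have prefS m : pref m.+1 = pref m ++ sdesc m.+1 (i m).
  have iota_m : iota 0 m.+1 = iota 0 m ++ [:: m] by rewrite -addn1 iotaD.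
  by rewrite /pref iota_m map_cat flatten_cat /= cats0.
elim=> [|m IHm] lt_mn; first by rewrite /seval big_nil inversions1.
have /andP[i_gt0 le_im] := c_ok (Ordinal lt_mn); rewrite -iE /= in i_gt0 le_im.
rewrite prefS seval_cat size_cat -IHm 1?ltnW //.
have -> : i m = m.+2 - (m.+2 - i m) by rewrite subKn.
apply: inversions_mulsdesc => //; last by lia.
move=> x lt_mx; apply: seval_fix; apply/allP => l /flatten_mapP[j].
rewrite mem_iota => /andP[_ lt_jm] /(allP (all_sdesc _ (ltnSn _))); lia.
Qed.

Lemma slenE al : slen al = inversions al.
Proof. by rewrite /slen; have [c c_ok [-> <-]] := normal_formP al; rewrite inversions_nf_word. Qed.

Lemma slen_sgenM i al : i < n -> slen (sgen i.+1 * al) =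
  if al (inord i) < al (inord i.+1) then (slen al).+1 else (slen al).-1.
Proof.
move=> lt_in; rewrite !slenE; case: ltngtP => [/(inversions_sgenM_asc lt_in) //| desc | /eqP].
  by rewrite [inversions al](inversions_sgenM_desc lt_in).
by rewrite perm_inord_neqS.
Qed.

Lemma slen_gt0 i al : i < n -> al (inord i.+1) < al (inord i) -> 0 < slen al.
Proof. by move=> lt_in desc; rewrite slenE (inversions_sgenM_desc lt_in). Qed.

Lemma slenV al : slen al^-1 = slen al.
Proof. by rewrite !slenE inversionsV. Qed.

Lemma normal_form_range al : all (fun i => 0 < i <= n) (normal_form al).
Proof.
have [c /forallP c_ok [-> _]] := normal_formP al.
apply/allP => l /flatten_mapP[j _ l_in].
have := allP (all_sdesc (c j) (ltnSn j.+1)) _ l_in; rewrite ltnS => le_lj.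
have := c_ok j; move: l_in; rewrite mem_rev mem_iota; have := ltn_ord j; lia.
Qed.

(** A letter put in front raises the length by at most one. Thus no word is shorter than the normal
    form, and [slen] is subadditive. *)
Lemma slen_seval w : all (fun i => 0 < i <= n) w -> slen (seval w) <= size w.
Proof.
elim: w => [|[|i] w IHw] //=; first by rewrite /seval big_nil leqn0 slen_eq0.
case/andP=> lt_in /IHw; rewrite seval_cons slen_sgenM //; case: ifP => //; lia.
Qed.

Lemma slenM al be : slen (al * be) <= slen al + slen be.
Proof.
rewrite -{1}[al]seval_normal_form -{1}[be]seval_normal_form -seval_cat -size_cat.
by rewrite slen_seval // all_cat !normal_form_range.
Qed.

Lemma slen1 : slen (1 : 'S_n.+1) = 0.
Proof. by apply/eqP; rewrite slen_eq0. Qed.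

Lemma perp1 al : perp al 1.
Proof. by rewrite /perp mulg1 slen1 addn0. Qed.

(** By subadditivity, each side says that the length of the triple product is the sum of the three
    lengths. *)
Lemma perpA al be ga : perp al be && perp (al * be) ga = perp be ga && perp al (be * ga).
Proof.
have := slenM al be; have := slenM be ga; have := slenM (al * be) ga.
have := slenM al (be * ga); rewrite /perp mulgA.
move: (slen al) (slen be) (slen ga) (slen _) (slen _) (slen _) => a b c ab bc abc; lia.
Qed.

(** * Generators as left divisors, and their common multiples *)

(** The first letter of the normal form works: the rest of the word bounds the length of the
    quotient from above, and subadditivity bounds it from below. *)
Lemma exists_left_descent al : al != 1 -> exists2 i, i < n & perp (sgen i.+1) (sgen i.+1 * al).
Proof.
move=> al_neq1.
have : size (normal_form al) = slen al by [].
have := normal_form_range al; have := seval_normal_form al.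
case: (normal_form al) => [alE _ /esym/eqP|[//|i] w alE /andP[/= lt_in w_ok] size_al].
  by rewrite slen_eq0 (negPf al_neq1).
exists i => //; have swE : seval w = sgen i.+1 * al.
  by rewrite -alE seval_cons mulgA sgenK mul1g.
have := slen_seval w_ok; have := slenM (sgen i.+1) (seval w).
have : slen (sgen i.+1) <= 1 by rewrite -[sgen _]mulg1 slen_sgenM // slen1; case: ifP.
by rewrite /perp swE mulgA sgenK mul1g; lia.
Qed.

Lemma slen_sgen i : i < n -> slen (sgen i.+1) = 1%N.
Proof.
move=> lt_in; rewrite -[sgen _]mulg1 slen_sgenM // slen1 !perm1 !inordK // ?ltnSn //.
exact: ltnW.
Qed.

(** The left-hand side expresses that [sgen i.+1] is a left divisor of [al]. *)
Lemma perp_sgen_desc i al : i < n ->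
  perp (sgen i.+1) (sgen i.+1 * al) = (al (inord i.+1) < al (inord i)).
Proof.
move=> lt_in; rewrite /perp slen_sgen // mulgA sgenK mul1g slen_sgenM //.
have := @slen_gt0 i al lt_in; case: ltngtP (perm_inord_neqS al lt_in) => //; lia.
Qed.

Lemma perp_sgen_asc i al : i < n ->
  perp al (sgen i.+1) = (al^-1 (inord i) < al^-1 (inord i.+1)).
Proof.
move=> lt_in; rewrite /perp slen_sgen // -slenV invMg sgenV slen_sgenM // slenV.
case: ifP; lia.
Qed.

(** [m] is the longest element of the dihedral subgroup generated by the two generators. The
    permutations satisfying [asc] are the shortest in their cosets of this subgroup, which is why
    lengths add. *)
Lemma two_generators_longest i j : i < n -> j < n -> i < j ->
  let asc (v : 'S_n.+1) := v (inord i) < v (inord i.+1) /\ v (inord j) < v (inord j.+1) in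
  let desc (v : 'S_n.+1) := v (inord i.+1) < v (inord i) /\ v (inord j.+1) < v (inord j) in
  exists m : 'S_n.+1, [/\ m^-1 = m, desc m,
    forall v, desc v -> asc (m * v) &
    forall v, asc v -> slen (m * v) = slen m + slen v].
Proof.
move=> lt_in lt_jn lt_ij asc desc.
pose a : 'I_n.+1 := inord i; pose b : 'I_n.+1 := inord i.+1.
pose c : 'I_n.+1 := inord j; pose d : 'I_n.+1 := inord j.+1.
have neq k l : k <= n -> l <= n -> k != l -> (inord k : 'I_n.+1) != inord l.
  by move=> le_kn le_ln; rewrite -val_eqE /= !inordK.
have lt k l : k <= n -> l <= n -> k < l -> (inord k : 'I_n.+1) < (inord l : 'I_n.+1).
  by move=> le_kn le_ln; rewrite !inordK.
have ia : sgen i.+1 a = b by rewrite sgenS tpermL.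
have ib : sgen i.+1 b = a by rewrite sgenS tpermR.
have jc : sgen j.+1 c = d by rewrite sgenS tpermL.
have jd : sgen j.+1 d = c by rewrite sgenS tpermR.
have id : sgen i.+1 d = d by rewrite sgenS tpermD // neq //; lia.
have ja : sgen j.+1 a = a by rewrite sgenS tpermD // neq //; lia.
have ab : a < b by apply: lt; lia.
have cd : c < d by apply: lt; lia.
have [eq_j | neq_j] := eqVneq j i.+1.
  have bc : c = b by rewrite /c eq_j.
  have sE := (ia, ib, jd, id, ja, bc, etrans (congr1 _ (esym bc)) jc).
  have bd : b < d by rewrite -bc.
  (* For adjacent generators [m] reverses [a < b < d]. From the innermost letter on, its letters
     meet the ascents [v a < v b], [v a < v d] and [v b < v d]. *)
  pose m := sgen i.+1 * (sgen j.+1 * sgen i.+1).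
  have slen_m v : asc v -> slen (m * v) = (slen v).+3.
    rewrite /asc -/a -/b -/c -/d bc => -[v1 v2].
    by rewrite /m -!mulgA !slen_sgenM // -/a -/b -/c -/d !permM ?sE v1 v2 (ltn_trans v1 v2).
  exists m; split; rewrite /desc /asc -/a -/b -/c -/d ?bc.
  - by rewrite /m !invMg !sgenV !mulgA.
  - by rewrite /m !permM !sE.
  - by move=> v; rewrite /m !permM !sE => -[].
  - move=> v v_asc; rewrite slen_m /asc -/a -/b -/c -/d ?bc //.
    (* The identity satisfies [asc], so the same formula gives [slen m]. *)
    have := slen_m 1; rewrite mulg1 slen1 => -> //.
    by rewrite /asc !perm1 -/a -/b -/c -/d bc.
have lt_ij1 : i.+1 < j by rewrite ltn_neqAle eq_sym neq_j.
have ic : sgen i.+1 c = c by rewrite sgenS tpermD // neq //; lia.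
have jb : sgen j.+1 b = b by rewrite sgenS tpermD // neq //; lia.
have sE := (ia, ib, ic, id, ja, jb, jc, jd).
(* Here the generators commute, and [m] is their product. *)
pose m := sgen i.+1 * sgen j.+1.
have slen_m v : asc v -> slen (m * v) = (slen v).+2.
  rewrite /asc -/a -/b -/c -/d => -[v1 v2].
  by rewrite /m -!mulgA !slen_sgenM // -/a -/b -/c -/d !permM !sE v1 v2.
exists m; split; rewrite /desc /asc -/a -/b -/c -/d.
- by rewrite /m invMg !sgenV conjgC [X in _ * X]tpermJ -/c -/d ic id.
- by rewrite /m !permM !sE.
- by move=> v; rewrite /m !permM !sE => -[].
- move=> v v_asc; rewrite slen_m //.
  by have := slen_m 1; rewrite mulg1 slen1 => -> //; rewrite /asc !perm1.
Qed.

(** For distinct generators [m] is the longest element above. Since [y] has both descents, [m * y]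
    has both ascents, so [m] divides [y]; since [x^-1] has both ascents, lengths add in [m * x^-1],
    the inverse of [x * m]. *)
Lemma left_descent_join i j (x y : 'S_n.+1) : i < n -> j < n ->
    perp (sgen i.+1) (sgen i.+1 * y) -> perp (sgen j.+1) (sgen j.+1 * y) ->
    perp x (sgen i.+1) -> perp x (sgen j.+1) ->
  exists m : 'S_n.+1, [/\ perp (sgen i.+1) (sgen i.+1 * m), perp (sgen j.+1) (sgen j.+1 * m),
    perp m (m^-1 * y) & perp x m].
Proof.
wlog lt_ij : i j / i < j => [IH lt_in lt_jn yi yj xi xj|lt_in lt_jn].
  have [lt_ij | lt_ji | eq_ij] := ltngtP i j.
  - exact: IH.
  - by have [m []] := IH j i lt_ji lt_jn lt_in yj yi xj xi; exists m.
  by subst j; exists (sgen i.+1); split; rewrite ?sgenV ?sgenK ?perp1.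
rewrite !perp_sgen_desc // !perp_sgen_asc // => yi yj xi xj.
have [m [mV [mi mj] m_asc m_len]] := two_generators_longest lt_in lt_jn lt_ij.
exists m; split; rewrite ?perp_sgen_desc // /perp.
  by rewrite mulKVg -m_len; [rewrite mV mulgA -{1}mV mulVg mul1g | rewrite mV; apply: m_asc].
by rewrite -slenV invMg mV m_len // slenV addnC.
Qed.

End Length.

(** * Differences of words, trivial combinations and ideals in the free algebra *)

Definition cat_ord X m1 m2 (x1 : 'I_m1 -> X) (x2 : 'I_m2 -> X) (i : 'I_(m1 + m2)) : X :=
  match split i with inl j => x1 j | inr j => x2 j end.

Lemma cat_ord_lshift X m1 m2 (x1 : 'I_m1 -> X) (x2 : 'I_m2 -> X) j :
  cat_ord x1 x2 (lshift m2 j) = x1 j.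
Proof. by rewrite /cat_ord (unsplitK (inl j)). Qed.

Lemma cat_ord_rshift X m1 m2 (x1 : 'I_m1 -> X) (x2 : 'I_m2 -> X) j :
  cat_ord x1 x2 (rshift m1 j) = x2 j.
Proof. by rewrite /cat_ord (unsplitK (inr j)). Qed.

Section FreeAlgebra.

Variables (k : fieldType) (T : choiceType).

Local Notation word := {fmonom T}.
Local Notation alg := {malg k[{fmonom T}]}.
Local Notation "u ** v" := (mmul u v) (at level 40, left associativity).

Implicit Types (f g h : alg) (u v w a b p q : word) (lt : rel word).

Local Open Scope ring_scope.

Lemma mul_words u v : << u >> * << v >> = << u ** v >> :> alg.
Proof. by rewrite malgM_def fgmulUU mulr1. Qed.

(** The support consists of the two distinct words [u] and [v], and asymmetry excludes [v] as a
    leading word. *)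
Lemma is_lead_subP lt u v u' : (forall x y, lt x y -> ~~ lt y x) -> lt v u ->
  is_lead lt (<< u >> - << v >> : alg) u' <-> u' = u.
Proof.
move=> lt_asym lt_vu; have neq_uv : u != v.
  by apply/eqP => eq_uv; move: lt_vu (lt_asym _ _ lt_vu); rewrite eq_uv => ->.
have coefE x : (<< u >> - << v >> : alg)@_x = (u == x)%:R - (v == x)%:R.
  by rewrite mcoeffB !mcoeffU1.
have suppE x : x \in msupp (<< u >> - << v >> : alg) = (x == u) || (x == v).
  rewrite -mcoeff_neq0 coefE ![x == _]eq_sym.
  have [<-|_] := eqVneq u x; first by rewrite [v == u]eq_sym (negPf neq_uv) subr0 oner_neq0.
  by have [_|_] := eqVneq v x; rewrite ?subr0 ?eqxx // sub0r oppr_eq0 oner_neq0.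
split=> [[+ max_u']|->].
  rewrite suppE => /orP[/eqP //|/eqP eq_u'].
  have := max_u' u; rewrite suppE eqxx eq_u' => /(_ isT neq_uv) /lt_asym.
  by rewrite lt_vu.
by split=> [|x]; rewrite suppE ?eqxx // => /orP[->|/eqP->].
Qed.

Section TrivialMod.

Variables (lt : rel word) (S : alg -> Prop) (w : word).

Lemma trivial_mod0 : trivial_mod lt S w 0.
Proof.
exists 0%N, (fun=> 0), (fun=> mone), (fun=> mone), (fun=> 0).
by split=> [[]|]; rewrite ?big_ord0.
Qed.

Lemma trivial_modD f g :
  trivial_mod lt S w f -> trivial_mod lt S w g -> trivial_mod lt S w (f + g).
Proof.
case=> m1 [c1 [a1 [b1 [s1 [S1 ->]]]]] [m2 [c2 [a2 [b2 [s2 [S2 ->]]]]]].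
exists (m1 + m2)%N, (cat_ord c1 c2), (cat_ord a1 a2), (cat_ord b1 b2), (cat_ord s1 s2).
split=> [i|]; first by rewrite /cat_ord; case: split => j; [apply: S1 | apply: S2].
rewrite big_split_ord; under [X in _ = X + _]eq_bigr do rewrite !cat_ord_lshift.
by under [X in _ = _ + X]eq_bigr do rewrite !cat_ord_rshift.
Qed.

Lemma trivial_modN f : trivial_mod lt S w f -> trivial_mod lt S w (- f).
Proof.
case=> m [c [a [b [s [Ss ->]]]]]; exists m, (fun i => - c i), a, b, s; split=> //.
by rewrite -sumrN; apply: eq_bigr => i _; rewrite scaleNr.
Qed.

Lemma trivial_mod_single a b s v :
  S s -> is_lead lt s v -> lt (a ** v ** b) w -> trivial_mod lt S w (<< a >> * s * << b >>).
Proof.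
move=> Ss s_v lt_w; exists 1%N, (fun=> 1), (fun=> a), (fun=> b), (fun=> s).
by split=> [_|]; [split=> //; exists v | rewrite big_ord1 scale1r].
Qed.

End TrivialMod.

Section Ideal.

Variable S : alg -> Prop.

Lemma in_ideal0 : in_ideal S 0.
Proof.
by exists 0%N, (fun=> 0), (fun=> 0), (fun=> 0); split=> [[]|]; rewrite ?big_ord0.
Qed.

Lemma in_idealD f g : in_ideal S f -> in_ideal S g -> in_ideal S (f + g).
Proof.
case=> m1 [a1 [b1 [s1 [S1 ->]]]] [m2 [a2 [b2 [s2 [S2 ->]]]]].
exists (m1 + m2)%N, (cat_ord a1 a2), (cat_ord b1 b2), (cat_ord s1 s2).
split=> [i|]; first by rewrite /cat_ord; case: split => j; [apply: S1 | apply: S2].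
rewrite big_split_ord; under [X in _ = X + _]eq_bigr do rewrite !cat_ord_lshift.
by under [X in _ = _ + X]eq_bigr do rewrite !cat_ord_rshift.
Qed.

Lemma in_idealM f g h : in_ideal S f -> in_ideal S (g * f * h).
Proof.
case=> m [a [b [s [Ss ->]]]]; exists m, (fun i => g * a i), (fun i => b i * h), s.
split; first exact: Ss.
have mulA5 (R : nzRingType) (x1 x2 x3 x4 x5 : R) :
  x1 * (x2 * x3 * x4) * x5 = x1 * x2 * x3 * (x4 * x5) by rewrite !mulrA.
by rewrite mulr_sumr mulr_suml; apply: eq_bigr => i _; apply: mulA5.
Qed.

Lemma in_idealN f : in_ideal S f -> in_ideal S (- f).
Proof. by move/(in_idealM (-1) 1); rewrite mulr1 mulN1r. Qed.

Lemma in_ideal_gen f : S f -> in_ideal S f.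
Proof.
move=> Sf; exists 1%N, (fun=> 1), (fun=> 1), (fun=> f).
by split=> //; rewrite big_ord1 mul1r mulr1.
Qed.

End Ideal.

Lemma in_ideal_mono (S S' : alg -> Prop) f :
  (forall g, S g -> in_ideal S' g) -> in_ideal S f -> in_ideal S' f.
Proof.
move=> SS' [m [a [b [s [Ss ->]]]]].
elim/big_ind: _ => [|g h|i _]; [exact: in_ideal0 | exact: in_idealD |].
exact/in_idealM/SS'.
Qed.

(** [rel_poly] orients relations by [lt] and discards identities; neither affects the ideal, which
    contains 0 and is closed under negation. *)
Lemma in_ideal_rel (R : word -> word -> Prop) lt u v :
  R u v -> in_ideal (rel_poly lt R) (<< u >> - << v >> : alg).
Proof.
move=> Ruv; have [->|neq_uv] := eqVneq u v; first by rewrite subrr; apply: in_ideal0.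
have : in_ideal (rel_poly lt R)
    (if lt v u then << u >> - << v >> else << v >> - << u >> : alg).
  by apply: in_ideal_gen; exists u, v.
case: (lt v u) => [uv|vu]; first exact: uv.
rewrite -opprB.
apply: in_idealN.
exact: vu.
Qed.

End FreeAlgebra.

(** * Asymmetry of the orderings *)

Lemma lexlt_asym (T : eqType) (lt : rel T) (s t : seq T) :
  (forall x y, lt x y -> ~~ lt y x) -> lexlt lt s t -> ~~ lexlt lt t s.
Proof.
move=> lt_asym; elim: s t => [|x s IHs] [|y t] //=.
case/orP=> [lt_xy | /andP[/eqP-> lt_st]]; rewrite negb_or.
  rewrite lt_asym //=; apply/nandP; left; apply/eqP => eq_yx.
  by move: lt_xy (lt_asym _ _ lt_xy); rewrite eq_yx => ->.
rewrite eqxx /= IHs // andbT; apply/negP => lt_yy.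
by have := lt_asym _ _ lt_yy; rewrite lt_yy.
Qed.

Lemma deglex_asym (T : choiceType) (lt : rel T) (u v : {fmonom T}) :
  (forall x y, lt x y -> ~~ lt y x) -> deglex lt u v -> ~~ deglex lt v u.
Proof.
move=> lt_asym; rewrite /deglex; case: ltngtP => //= _; exact: lexlt_asym.
Qed.

Lemma letter_lt_asym n (x y : letter n) : letter_lt x y -> ~~ letter_lt y x.
Proof.
rewrite /letter_lt; case: ltngtP => //= _; apply: lexlt_asym => i j; lia.
Qed.

(** * Words of permutations and the uniform form of the relations *)

Section Words.

Variable n : nat.
Implicit Types (al be ga de ep : 'S_n.+1) (s t : seq 'S_n.+1).
Implicit Types (x y z : letter n) (u v w : {fmonom letter n}).

Local Open Scope group_scope.
Local Notation "u ** v" := (mmul u v) (at level 40, left associativity).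
Local Notation lt := (deglex (@letter_lt n)).

(* Dropping the trivial permutations makes both families of relations
   instances of the single rule al . (be ga) -> (al be) . ga. *)
Definition word_of s : {fmonom letter n} := FMonom (pmap insub s).

Lemma word_of_cat s t : word_of (s ++ t) = word_of s ** word_of t.
Proof. by apply/val_inj; rewrite /= fmM /= pmap_cat. Qed.

Lemma word_of_val (s : seq (letter n)) : word_of (map val s) = FMonom s.
Proof. by rewrite /word_of map_pK //; exact: valK. Qed.

Lemma fdeg_word_of s : fdeg (word_of s) = count (fun al => al != 1) s.
Proof. by rewrite /fdeg /= size_pmap_sub. Qed.

(** No entry of the larger word is dropped. Either the other word has fewer letters, or the first
    difference is [al'] against [al], and the longer permutation is the smaller letter. *)
Lemma word_of_lt s al al' t t' : all (fun be => be != 1) (s ++ al :: t) ->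
  slen al < slen al' -> size t' <= size t ->
  lt (word_of (s ++ al' :: t')) (word_of (s ++ al :: t)).
Proof.
rewrite all_cat /= => /and3P[s1 al1 t1] lt_al le_t.
have al'1 : al' != 1 by rewrite -slen_eq0 -lt0n (leq_ltn_trans _ lt_al).
rewrite /deglex !fdeg_word_of !count_cat /= al1 al'1 ltn_add2l eqn_add2l ltn_add2l eqn_add2l.
have -> : count (fun be => be != 1) t = size t by apply/eqP; rewrite -all_count.
have : count (fun be => be != 1) t' <= size t by apply: leq_trans (count_size _ _) le_t.
rewrite leq_eqVlt => /orP[/eqP eq_t|-> //].
apply/orP; right; rewrite eq_t eqxx /= !pmap_cat /=.
have [x -> x_al] : exists2 x : letter n, insub al = Some x & val x = al.
  by exists (Sub al al1); rewrite ?insubT.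
have [x' -> x'_al'] : exists2 x : letter n, insub al' = Some x & val x = al'.
  by exists (Sub al' al'1); rewrite ?insubT.
have lt_x : letter_lt x' x by rewrite /letter_lt x_al x'_al' lt_al.
by elim: (pmap insub s) => [|y s' IHs] /=; rewrite ?lt_x // eqxx IHs orbT.
Qed.

Lemma word_of_slide_lt s al be t t' : all (fun ga => ga != 1) (s ++ al :: t) ->
  be != 1 -> perp al be -> size t' <= size t ->
  lt (word_of (s ++ (al * be) :: t')) (word_of (s ++ al :: t)).
Proof.
move=> st1 be1 /eqP al_be; apply: word_of_lt => //.
by rewrite al_be -[X in X < _]addn0 ltn_add2l lt0n slen_eq0.
Qed.

(** The case [ga = 1] gives the braid relations, the case [ga != 1] the slides. *)
Lemma garside_relP u v : garside_rel u v <->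
  exists x y be ga, [/\ be != 1, perp (val x) be, perp be ga, val y = be * ga
    & u = FMonom [:: x; y] /\ v = word_of [:: val x * be; ga]].
Proof.
have insubE x : insub (val x) = Some x by rewrite valK.
have insub1 : insub (1 : 'S_n.+1) = None :> option (letter n) by rewrite insubF ?eqxx.
split.
  case=> [_ _ [x y xy perp_xy xyE]|x b c xb bc perp_xb perp_bc xbE bcE].
    exists x, y, (val y), 1; rewrite mulg1 perp1 (valP y) -xyE /word_of /= insubE insub1.
    by split.
  exists x, bc, (val b), (val c); rewrite (valP b) -xbE.
  by rewrite -(word_of_val [:: xb; c]); split.
case=> x [y [be [ga [be1 perp_xb perp_bc yE [-> ->]]]]].
have xb1 : val x * be != 1 by exact: (perp_neq1 (valP x) perp_xb).
have [ga1|ga1] := eqVneq ga 1.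
  rewrite ga1 mulg1 in yE; rewrite ga1 /word_of /= insub1 insubT /=.
  by apply/GarsideBraid/BraidRel => /=; rewrite yE.
pose xb : letter n := Sub (val x * be) xb1; pose c : letter n := Sub ga ga1.
have := word_of_val [:: xb; c]; rewrite /= => ->.
by apply: (@GarsideSlide n x (Sub be be1) c).
Qed.

(** Hence the leading word is always the two-letter left-hand side. *)
Lemma garside_lt u v : garside_rel u v -> lt v u.
Proof.
case/garside_relP => x [y [be [ga [be1 x_be _ yE [-> ->]]]]].
rewrite -word_of_val; apply: (@word_of_slide_lt [::]) => //.
by rewrite /= (valP x) (valP y).
Qed.

Lemma lt_word_asym u v : lt u v -> ~~ lt v u.
Proof. exact/deglex_asym/letter_lt_asym. Qed.

(** * Words linked by relations below a given word *)

Section Connected.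

Variables (k : fieldType) (w : {fmonom letter n}).

Local Notation S := (@rel_poly k _ lt (@garside_rel n)).

(** Triviality of a difference of words is an equivalence relation, so compositions can be resolved
    along chains of relations whose leading words stay below [w]. *)
Definition connected u v : Prop := trivial_mod lt S w (<< u >> - << v >>)%R.

Lemma connected_refl u : connected u u.
Proof. by rewrite /connected subrr; apply: trivial_mod0. Qed.

Lemma connected_sym u v : connected u v -> connected v u.
Proof. by move/trivial_modN; rewrite opprB. Qed.

Lemma connected_trans v u u' : connected u v -> connected v u' -> connected u u'.
Proof. by move=> uv /(trivial_modD uv); rewrite subrKA. Qed.

Lemma connected_rel u v p q : garside_rel u v -> lt (p ** u ** q) w ->
  connected (p ** u ** q) (p ** v ** q).
Proof.
move=> Ruv lt_w; rewrite /connected -!mul_words -mulrBl -mulrBr.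
apply: (@trivial_mod_single _ _ _ _ _ _ _ _ u) => //.
  exists u, v; rewrite garside_lt //; split=> //.
  by apply/eqP => eq_uv; move: (garside_lt Ruv) (lt_word_asym (garside_lt Ruv)); rewrite eq_uv => ->.
apply/is_lead_subP => //; [exact: lt_word_asym | exact: garside_lt].
Qed.

(** Entries may be trivial, so either side can be the larger one: for [al = 1] the rule is the
    merging of [be] and [ga] read backwards. This is why both words are bounded by [w]. *)
Lemma connected_slide s t al be ga : perp al be -> perp be ga ->
  lt (word_of (s ++ [:: al; be * ga] ++ t)) w ->
  lt (word_of (s ++ [:: al * be; ga] ++ t)) w ->
  connected (word_of (s ++ [:: al; be * ga] ++ t)) (word_of (s ++ [:: al * be; ga] ++ t)).
Proof.
move=> perp_ab perp_bc; have insub1 : insub (1 : 'S_n.+1) = None :> option (letter n).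
  by rewrite insubF ?eqxx.
have [->|be1] := eqVneq be 1; first by rewrite mul1g mulg1 => _ _; apply: connected_refl.
have bega1 : be * ga != 1 by exact: perp_neq1 be1 perp_bc.
rewrite !word_of_cat !mulmA.
have [->|al1] := eqVneq al 1.
  rewrite mul1g; have [->|ga1] := eqVneq ga 1.
    by rewrite mulg1 /word_of /= insub1 => _ _; apply: connected_refl.
  move=> _ lt_w; apply: connected_sym.
  (* Moving the dropped 1 to the end gives the merging the shape of the uniform rule with last
     factor 1. *)
  have -> : word_of [:: 1; be * ga] = word_of [:: be * ga; 1] by rewrite /word_of /= insub1.
  apply: connected_rel lt_w; apply/garside_relP.
  exists (Sub be be1), (Sub ga ga1), ga, 1; rewrite perp1 mulg1; split=> //.
  by rewrite -word_of_val.
move=> lt_w _; apply: connected_rel lt_w; apply/garside_relP.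
by exists (Sub al al1), (Sub (be * ga) bega1), be, ga; split=> //; rewrite -word_of_val.
Qed.

End Connected.

(** * Resolution of the two kinds of compositions *)

Variable k : fieldType.

Local Notation S := (@rel_poly k _ lt (@garside_rel n)).

Lemma overlap_connected x y z be ga de ep : be != 1 -> de != 1 ->
    perp (val x) be -> perp be ga -> val y = be * ga ->
    perp (val y) de -> perp de ep -> val z = de * ep ->
  connected k (FMonom [:: x; y; z])
    (word_of [:: val x; val y * de; ep]) (word_of [:: val x * be; ga; val z]).
Proof.
move=> be1 de1 x_be be_ga yE y_de de_ep zE; rewrite -word_of_val /=.
have [x1 [y1 z1]] := (valP x, (valP y, valP z)).
have xyz1 : all (fun al => al != 1) [:: val x; val y; val z] by rewrite /= x1 y1 z1.
(* The lengths of [be], [ga] and [de] add up in [val y * de]; regrouping gives the missing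
   conditions for both slides to the common word. *)
have /andP[ga_de be_gade] : perp ga de && perp be (ga * de) by rewrite -perpA be_ga -yE.
apply: (@connected_trans _ _ (word_of [:: val x * be; ga * de; ep])).
  have yde : val y * de = be * (ga * de) by rewrite yE mulgA.
  rewrite yde; apply: (@connected_slide _ _ [::] [:: ep]) => //;
    last exact: (@word_of_slide_lt [::]).
  by rewrite -yde; apply: (@word_of_slide_lt [:: val x]).
apply: connected_sym; rewrite zE.
by apply: (@connected_slide _ _ [:: val x * be] [::]) => //=;
  rewrite -?zE; apply: (@word_of_slide_lt [::]).
Qed.

(* The left divisors of y by which x can be extended form a set closed under
   nontrivial left divisors. It is connected, because each of its elements is
   divisible by a generator, and any two of its generators divide a common
   element, the longest element of the dihedral subgroup they generate. *)
Lemma same_lead_connected x y be ga be' ga' : be != 1 -> be' != 1 ->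
    perp (val x) be -> perp be ga -> val y = be * ga ->
    perp (val x) be' -> perp be' ga' -> val y = be' * ga' ->
  connected k (FMonom [:: x; y])
    (word_of [:: val x * be; ga]) (word_of [:: val x * be'; ga']).
Proof.
move=> be1 be'1 x_be be_ga yE x_be' be'_ga' y'E.
have gaE : ga = be^-1 * val y by rewrite yE mulKg.
have ga'E : ga' = be'^-1 * val y by rewrite y'E mulKg.
rewrite gaE in be_ga *; rewrite ga'E in be'_ga' *.
(* [P] selects the nontrivial left divisors of [y] that extend [x]; [V a] results from [x y] by
   moving [a] into the first letter. *)
pose P a := [&& a != 1, perp (val x) a & perp a (a^-1 * val y)].
pose V a := word_of [:: val x * a; a^-1 * val y].
suff main : forall a a', P a -> P a' -> connected k (FMonom [:: x; y]) (V a) (V a').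
  by apply: main; apply/and3P.
have V_lt a : P a -> lt (V a) (FMonom [:: x; y]).
  case/and3P=> a1 x_a _; rewrite -word_of_val; apply: (@word_of_slide_lt [::]) => //=.
  by rewrite (valP x) (valP y).
(* Regroup the triples [x], [a], [a^-1 * m] and [a], [a^-1 * m], [m^-1 * y]. *)
have div_ok a m : a != 1 -> perp a (a^-1 * m) -> P m ->
    [/\ P a, perp (val x * a) (a^-1 * m) & perp (a^-1 * m) (m^-1 * val y)].
  move=> a1 a_m /and3P[m1 x_m m_y].
  have := perpA (val x) a (a^-1 * m); rewrite mulKVg a_m x_m => /andP[x_a xa_m].
  have := perpA a (a^-1 * m) (m^-1 * val y); rewrite mulKVg a_m m_y -mulgA mulKVg.
  by move=> /esym/andP[am_y a_y]; split=> //; apply/and3P.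
(* Sliding the quotient [a^-1 * m] to the left turns [V a] into [V m]. *)
have up a m : a != 1 -> perp a (a^-1 * m) -> P m ->
    connected k (FMonom [:: x; y]) (V a) (V m).
  move=> a1 a_m Pm; have [Pa xa_m am_y] := div_ok _ _ a1 a_m Pm.
  have := @connected_slide k (FMonom [:: x; y]) [::] [::] _ _ _ xa_m am_y.
  by rewrite /= -!mulgA !mulKVg; apply; apply: V_lt.
have atom a : P a -> exists i, [/\ i < n, P (sgen n i.+1) &
    connected k (FMonom [:: x; y]) (V (sgen n i.+1)) (V a)].
  move=> Pa; have [a1 _ _] := and3P Pa; have [i lt_in] := exists_left_descent a1.
  rewrite -{2}(sgenV n) => i_a; have i1 : sgen n i.+1 != 1 by rewrite -slen_eq0 slen_sgen.
  have [Pi _ _] := div_ok _ _ i1 i_a Pa.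
  exists i; split; [exact: lt_in | exact: Pi |].
  exact: up.
move=> a a' /atom[i [lt_in Pi ia]] /atom[j [lt_jn Pj ja]].
apply: connected_trans (connected_sym ia) _; apply: connected_trans ja.
have [[i1 x_i i_y] [j1 x_j j_y]] := (and3P Pi, and3P Pj).
rewrite !sgenV in i_y j_y.
have [m [i_m j_m m_y x_m]] := left_descent_join lt_in lt_jn i_y j_y x_i x_j.
have Pm : P m.
  (* [m] is nontrivial because a generator, of length one, divides it. *)
  apply/and3P; split=> //; rewrite -slen_eq0 -(mulKg (sgen n i.+1) m) sgenV.
  by rewrite (eqP i_m) slen_sgen.
apply: (@connected_trans _ _ (V m)); last apply: connected_sym.
  by apply: up; rewrite ?sgenV.
by apply: up; rewrite ?sgenV.
Qed.

(** * The Groebner-Shirshov property *)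

Lemma rel_poly_lead f : S f ->
  exists u v, [/\ garside_rel u v, f = (<< u >> - << v >>)%R & forall w, is_lead lt f w <-> w = u].
Proof.
case=> u [v [Ruv _ ->]]; rewrite garside_lt //; exists u, v; split=> // w.
by apply: is_lead_subP; [exact: lt_word_asym | exact: garside_lt].
Qed.

Lemma mulrB_overlap (R : nzRingType) (u v u' v' a b : R) : (u * b = a * u' ->
  (u - v) * b - a * (u' - v') = a * v' - v * b)%R.
Proof. by move=> eq_w; rewrite mulrBl mulrBr eq_w opprB addrC addrA subrK. Qed.

Lemma mulrB_inclusion (R : nzRingType) (u v a b v' : R) :
  (a * u * b - v - a * (u - v') * b = a * v' * b - v)%R.
Proof. by rewrite mulrBr mulrBl opprB addrC addrA subrK. Qed.

(** A slide telescopes through the product [x * b * c]. The factors 1 match the two-sided multiples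
    of [in_idealM]. *)
Lemma mulrB_slide (R : nzRingType) (x b c xb bc : R) :
  (x * - (b * c - bc) * 1 + 1 * (x * b - xb) * c = x * bc - xb * c)%R.
Proof. by rewrite opprB mulr1 mul1r mulrBr mulrBl mulrA addrA subrK. Qed.

Lemma overlap_diff u v u' v' a b : u ** b = a ** u' ->
  ((<< u >> - << v >>) * << b >> - << a >> * (<< u' >> - << v' >>)
    = << a ** v' >> - << v ** b >> :> {malg k[{fmonom letter n}]})%R.
Proof.
move=> eq_w; rewrite -!mul_words; apply: mulrB_overlap.
by rewrite !mul_words eq_w.
Qed.

Lemma inclusion_diff u v u' v' a b : u = a ** u' ** b ->
  ((<< u >> - << v >>) - << a >> * (<< u' >> - << v' >>) * << b >>
    = << a ** v' ** b >> - << v >> :> {malg k[{fmonom letter n}]})%R.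
Proof.
move=> ->; rewrite -!mul_words; exact: mulrB_inclusion.
Qed.

Lemma fmonom_cat (s t : seq (letter n)) : FMonom s ** FMonom t = FMonom (s ++ t).
Proof. by apply/val_inj; rewrite /= fmM. Qed.

Lemma garside_GS_basis : GS_basis lt S.
Proof.
split=> [f Sf|f g u0 u0' a b Sf Sg|f g u0 u0' a b Sf Sg].
- have [u [v [Ruv fE leadE]]] := rel_poly_lead Sf; exists u; first exact/leadE.
  rewrite fE mcoeffB !mcoeffU1 eqxx; have [eq_vu|_] := eqVneq v u; last by rewrite subr0.
  by move: (garside_lt Ruv) (lt_word_asym (garside_lt Ruv)); rewrite eq_vu => ->.
all: have [u [v [Ruv -> leadu]]] := rel_poly_lead Sf.
all: have [u' [v' [Ruv' -> leadu']]] := rel_poly_lead Sg.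
all: move=> /leadu-> /leadu'->.
all: have [x [y [be [ga [be1 x_be be_ga yE [-> ->]]]]]] := (garside_relP _ _).1 Ruv.
all: have [x' [y' [de [ep [de1 x_de de_ep y'E [-> ->]]]]]] := (garside_relP _ _).1 Ruv'.
all: case: a b => [sa] [sb] eq_w.
- have := congr1 (@fmonom_val _) eq_w; rewrite !fmM /= => eq_s lt_size.
  rewrite (overlap_diff _ _ eq_w); move: eq_s lt_size; rewrite /fdeg fmM /=.
  (* With [sa] empty the leading words coincide; with one letter they overlap in a letter; a longer
     [sa] contradicts the size bound. *)
  case: sa eq_w => [|s1 [|s2 sa]] eq_w /=.
  + case=> eq_x eq_y -> _; rewrite -eq_x in x_de *; rewrite -eq_y in y'E.
    rewrite !fmonom_cat !cats0 !cat0s.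
    apply: connected_sym; exact: same_lead_connected be1 de1 x_be be_ga yE x_de de_ep y'E.
  + case=> <- eq_y -> _; rewrite -eq_y in x_de *.
    rewrite [X in trivial_mod _ _ X]fmonom_cat -(word_of_val [:: x]) -(word_of_val [:: y']).
    rewrite -!word_of_cat /=; exact: overlap_connected be1 de1 x_be be_ga yE x_de de_ep y'E.
  by case=> _ _ ->; rewrite size_cat /=; lia.
- have := congr1 (@fmonom_val _) eq_w; rewrite !fmM /= => eq_s.
  rewrite (inclusion_diff _ _ eq_w).
  (* Both leading words have two letters, so an inclusion is an equality. *)
  have [sa0 sb0] : sa = [::] /\ sb = [::].
    by move/(congr1 size): eq_s; rewrite !size_cat /=; case: sa {eq_w}; case: sb => //= *; lia.
  move: eq_s; rewrite sa0 sb0 /= => -[eq_x eq_y].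
  rewrite -eq_x in x_de *; rewrite -eq_y in y'E; rewrite !fmonom_cat !cats0 !cat0s.
  apply: connected_sym; exact: same_lead_connected be1 de1 x_be be_ga yE x_de de_ep y'E.
Qed.

(** * Equality of the two ideals *)

Lemma garside_ideal f : in_ideal S f <-> in_ideal (rel_poly (k := k) lt (@braid_rel n)) f.
Proof.
split; apply: in_ideal_mono => g.
  case/rel_poly_lead=> u [v [Ruv -> _]]; case: {u v} Ruv => [u v|x b c xb bc x_b b_c xbE bcE].
    exact: in_ideal_rel.
  have Ebc : braid_rel (FMonom [:: b; c]) (FMonom [:: bc]) by apply: BraidRel.
  have Exb : braid_rel (FMonom [:: x; b]) (FMonom [:: xb]) by apply: BraidRel.
  pose l y : {malg k[{fmonom letter n}]} := (<< FMonom [:: y] >>)%R.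
  have pairE y z : (<< FMonom [:: y; z] >> = l y * l z)%R by rewrite mul_words fmonom_cat.
  have idbc : in_ideal (rel_poly lt (@braid_rel n)) (l b * l c - l bc)%R.
    by rewrite -pairE; apply: in_ideal_rel.
  have idxb : in_ideal (rel_poly lt (@braid_rel n)) (l x * l b - l xb)%R.
    by rewrite -pairE; apply: in_ideal_rel.
  rewrite (pairE x bc) (pairE xb c) -(mulrB_slide (l x) (l b) (l c)).
  apply: in_idealD; apply: in_idealM; [apply: in_idealN; exact: idbc | exact: idxb].
case=> u [v [Ruv neq_uv ->]]; apply: in_ideal_gen; exists u, v.
by split=> //; apply: GarsideBraid.
Qed.

End Words.

Theorem theorem2p4 (n : nat) (k : fieldType) (hn : 0 < n) :
  monoid_GS_basis k (deglex (@letter_lt n)) (@braid_rel n) (@garside_rel n).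
Proof. by split; [apply: garside_GS_basis | move=> f; apply: garside_ideal]. Qed.
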